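(* The typical subranks of real $4\times4\times4$ tensors are exactly $2$ and $3$.
   Context: For $r \geq 0$ let $I_r := \sum_{j=1}^r e_j \otimes e_j \otimes e_j$. The subrank of $T \in \mathbb{R}^{n_1} \otimes \mathbb{R}^{n_2} \otimes \mathbb{R}^{n_3}$ is $Q(T) := \max\{ r \mid \exists\ \mathbb{R}\text{-linear } \varphi_i : \mathbb{R}^{n_i} \to \mathbb{R}^r,\ (\varphi_1 \otimes \varphi_2 \otimes \varphi_3) T = I_r\}$. An integer $r$ is a typical subrank of the format $n_1\times n_2\times n_3$ if $\{T \mid Q(T) = r\}$ contains a nonempty Euclidean-open subset of $\mathbb{R}^{n_1} \otimes \mathbb{R}^{n_2} \otimes \mathbb{R}^{n_3}$. *)

(* Defs.v *)
From HB Require Import structures.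
From mathcomp Require Import all_boot all_order all_algebra.
From mathcomp Require Import all_classical all_reals all_analysis.
Set Implicit Arguments. Unset Strict Implicit. Unset Printing Implicit Defensive.
Import Order.TTheory GRing.Theory Num.Theory.
Import numFieldNormedType.Exports.
Local Open Scope ring_scope.
Local Open Scope classical_set_scope.

(* Tensors in R^n1 (x) R^n2 (x) R^n3, viewed as arrays of coordinates
   T (i, j, k) w.r.t. the standard basis e_i (x) e_j (x) e_k.
   The type carries the product (= Euclidean, since the index set is
   finite) topology. *)
Definition tensor (R : realType) (n1 n2 n3 : nat) : topologicalType :=
  {ptws ('I_n1 * 'I_n2 * 'I_n3)%type -> R}.

Definition unit_tensor (R : realType) (r : nat) : tensor R r r r :=
  fun t => if (t.1.1 == t.1.2) && (t.1.2 == t.2) then 1 else 0.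

(* (phi1 (x) phi2 (x) phi3) T, where phi_i : R^{n_i} -> R^r is given by its
   r x n_i matrix (every R-linear map R^{n_i} -> R^r is of this form). *)
Definition tensor_apply (R : realType) (n1 n2 n3 r : nat)
    (A1 : 'M[R]_(r, n1)) (A2 : 'M[R]_(r, n2)) (A3 : 'M[R]_(r, n3))
    (T : tensor R n1 n2 n3) : tensor R r r r :=
  fun t => \sum_(i < n1) \sum_(j < n2) \sum_(k < n3)
             A1 t.1.1 i * A2 t.1.2 j * A3 t.2 k * T (i, j, k).

Definition restricts_to_unit (R : realType) (n1 n2 n3 : nat)
    (T : tensor R n1 n2 n3) (r : nat) : Prop :=
  exists (A1 : 'M[R]_(r, n1)) (A2 : 'M[R]_(r, n2)) (A3 : 'M[R]_(r, n3)),
    tensor_apply A1 A2 A3 T = @unit_tensor R r.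

Definition subrank_eq (R : realType) (n1 n2 n3 : nat)
    (T : tensor R n1 n2 n3) (r : nat) : Prop :=
  restricts_to_unit T r /\ (forall r', restricts_to_unit T r' -> (r' <= r)%N).

Definition typical_subrank (R : realType) (n1 n2 n3 r : nat) : Prop :=
  exists U : set (tensor R n1 n2 n3),
    open U /\ U !=set0 /\ U `<=` [set T | subrank_eq T r].

(* Main.v *)
From HB Require Import structures.
Require Import Defs.
From mathcomp Require Import all_boot all_order all_algebra.
From mathcomp Require Import all_classical all_reals all_analysis.
From mathcomp Require Import ring lra zify.
Set Implicit Arguments. Unset Strict Implicit. Unset Printing Implicit Defensive.
Import Order.TTheory GRing.Theory Num.Theory.
Import numFieldNormedType.Exports.
Local Open Scope ring_scope.
Local Open Scope classical_set_scope.

(* T restricts to I_r iff there are vectors x_i, y_j, z_k (i, j, k <= r) with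
   T(x_i, y_j, z_k) = delta_ijk.

   Generically Q(T) >= 2: take x_i, y_j among the standard basis; the four
   functionals T(x_i, y_j, -) are generically a basis of the dual of R^4, so the
   z_k are obtained by inverting a 4x4 matrix.  Generically Q(T) < 4: if Q(T) = 4
   the slices M_a of T are simultaneously equivalent to diagonal matrices, whence
   the polynomial identity M_a adj(M_b) M_c = M_c adj(M_b) M_a.

   Q(T) = 2 near the quaternion multiplication: T(x, y, -) <> 0 for all nonzero
   x, y is an open condition, and it excludes Q(T) >= 3, since T(x_1, y_2, -) and
   T(x_1, y_3, -) vanish on the same three-dimensional space, hence are
   dependent.

   Q(T) = 3 on an open set: near a suitable T_0, the 18 equations
   T(x_i, y_j, e_k) = 0 (i <> j, k <= 3) in 18 unknown coordinates of the x_i and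
   y_j have invertible derivative and are solved by a contraction; the matrix
   T(x_i, y_i, e_k) stays near the identity, and its inverse gives the z_k. *)

(** * Polynomial functions of a tensor *)

Definition tensor_ball (R : realType) (n1 n2 n3 : nat)
    (S : tensor R n1 n2 n3) (e : R) : set (tensor R n1 n2 n3) :=
  [set T | forall a b c, `|T (a, b, c) - S (a, b, c)| < e].

Lemma tensor_entry_continuous (R : realType) (n1 n2 n3 : nat)
    (t : 'I_n1 * 'I_n2 * 'I_n3) :
  continuous (fun T : tensor R n1 n2 n3 => T t : R).
Proof. exact: (@proj_continuous _ (fun=> R) t). Qed.

Lemma tensor_ball_open (R : realType) (n1 n2 n3 : nat)
    (S : tensor R n1 n2 n3) (e : R) : open (tensor_ball S e).
Proof.
pose B t := [set T : tensor R n1 n2 n3 | `|T t - S t| < e].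
have -> : tensor_ball S e = \bigcap_(t in setT) B t.
  apply/seteqP; split=> [T hT [[a b] c] _|T hT a b c]; first exact: hT.
  exact: (hT (a, b, c) I).
have Bo t : open (B t).
  have -> : B t = (fun T : tensor R n1 n2 n3 => T t : R) @^-1` ball (S t) e.
    by apply/seteqP; split=> T; rewrite /B /= /ball /= distrC.
  apply: open_comp (ball_open _ _) => T _; exact: tensor_entry_continuous.
rewrite openE => T hT; rewrite /interior.
have : \forall V \near T, forall t, B t V.
  apply: (@filter_forall _ _ (fun t V => B t V) (nbhs T)) => t.
  by apply: open_nbhs_nbhs; split=> //; exact: hT.
by apply: filterS => V hV t _; exact: hV.
Qed.

Definition tensor_line (R : realType) (n1 n2 n3 : nat)
    (T S : tensor R n1 n2 n3) (s : R) : tensor R n1 n2 n3 :=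
  fun t => T t + s * (S t - T t).

Lemma tensor_line_continuous (R : realType) (n1 n2 n3 : nat)
    (T S : tensor R n1 n2 n3) : continuous (tensor_line T S).
Proof.
move=> s; apply/cvg_sup => t.
(* Convergence is checked one coordinate at a time, each evaluation map being surjective. *)
rewrite cvg_image; last first.
  by apply/seteqP; split=> // x _; exists (fun=> x).
move=> W /= Wn.
have : \forall u \near s, W (tensor_line T S u t).
  suff : (fun u => tensor_line T S u t) @ s --> tensor_line T S s t.
    by apply.
  apply: (@cvgD _ R^o); first exact: cvg_cst.
  by apply: (@cvgM R); [exact: cvg_id | exact: cvg_cst].
rewrite /nbhs /= => h.
exists (@^~ t @^-1` W) => //.
by apply/seteqP; split=> [x [V hV <-] //|x Wx]; exists (fun=> x).
Qed.

(** Continuity and polynomiality along lines pass to sums and products, and suffice for the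
    nonvanishing locus, if nonempty, to be open and dense. *)
Definition polyfun (R : realType) (n1 n2 n3 : nat)
    (f : tensor R n1 n2 n3 -> R) : Prop :=
  continuous f /\
  forall T S, exists p : {poly R}, forall s, f (tensor_line T S s) = p.[s].

Section PolyFun.
Variables (R : realType) (n1 n2 n3 : nat).
Implicit Types f g : tensor R n1 n2 n3 -> R.

Lemma polyfun_cst c : polyfun (fun _ : tensor R n1 n2 n3 => c).
Proof.
split=> [|T S]; first exact: cst_continuous.
by exists c%:P => s; rewrite hornerC.
Qed.

Lemma polyfun_entry t : polyfun (fun T : tensor R n1 n2 n3 => T t).
Proof.
split=> [|T S]; first exact: tensor_entry_continuous.
by exists ((T t)%:P + 'X * (S t - T t)%:P) => s; rewrite !hornerE.
Qed.

Lemma polyfunD f g : polyfun f -> polyfun g -> polyfun (fun T => f T + g T).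
Proof.
move=> [cf pf] [cg pg]; split=> [T|T S].
  by apply: (@continuousD _ R^o _ f g); [exact: cf | exact: cg].
have [p pE] := pf T S; have [q qE] := pg T S.
by exists (p + q) => s; rewrite hornerD pE qE.
Qed.

Lemma polyfunM f g : polyfun f -> polyfun g -> polyfun (fun T => f T * g T).
Proof.
move=> [cf pf] [cg pg]; split=> [T|T S].
  by apply: (@continuousM _ _ f g); [exact: cf | exact: cg].
have [p pE] := pf T S; have [q qE] := pg T S.
by exists (p * q) => s; rewrite hornerM pE qE.
Qed.

Lemma polyfun_sum (I : Type) (r : seq I) (P : pred I)
    (F : I -> tensor R n1 n2 n3 -> R) :
  (forall i, polyfun (F i)) -> polyfun (fun T => \sum_(i <- r | P i) F i T).
Proof.
move=> hF; elim: r => [|i r IH].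
  by under eq_fun do rewrite big_nil; exact: polyfun_cst.
under eq_fun do rewrite big_cons.
by case: (P i) => //; exact: polyfunD.
Qed.

Lemma polyfun_prod (I : Type) (r : seq I) (P : pred I)
    (F : I -> tensor R n1 n2 n3 -> R) :
  (forall i, polyfun (F i)) -> polyfun (fun T => \prod_(i <- r | P i) F i T).
Proof.
move=> hF; elim: r => [|i r IH].
  by under eq_fun do rewrite big_nil; exact: polyfun_cst.
under eq_fun do rewrite big_cons.
by case: (P i) => //; exact: polyfunM.
Qed.

Lemma polyfun_det (n : nat) (A : tensor R n1 n2 n3 -> 'M[R]_n) :
  (forall i j, polyfun (fun T => A T i j)) -> polyfun (fun T => \det (A T)).
Proof.
move=> hA; apply: polyfun_sum => s; apply: polyfunM; first exact: polyfun_cst.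
by apply: polyfun_prod => i.
Qed.

Lemma polyfun_adj (n : nat) (A : tensor R n1 n2 n3 -> 'M[R]_n) :
  (forall i j, polyfun (fun T => A T i j)) ->
  forall i j, polyfun (fun T => (\adj (A T)) i j).
Proof.
move=> hA i j; under eq_fun do rewrite mxE.
apply: polyfunM; first exact: polyfun_cst.
by apply: polyfun_det => k l; under eq_fun do rewrite !mxE; exact: hA.
Qed.

Lemma polyfun_mulmx (m n p : nat) (A : tensor R n1 n2 n3 -> 'M[R]_(m, n))
    (B : tensor R n1 n2 n3 -> 'M[R]_(n, p)) :
  (forall i j, polyfun (fun T => A T i j)) ->
  (forall i j, polyfun (fun T => B T i j)) ->
  forall i j, polyfun (fun T => (A T *m B T) i j).
Proof.
move=> hA hB i j; under eq_fun do rewrite mxE.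
by apply: polyfun_sum => k; exact: polyfunM.
Qed.

End PolyFun.

Lemma polyfun_neq0_open (R : realType) (n1 n2 n3 : nat)
    (f : tensor R n1 n2 n3 -> R) : polyfun f -> open [set T | f T != 0].
Proof.
move=> [cf _].
have -> : [set T | f T != 0] = f @^-1` [set x | x != 0] by [].
by apply: open_comp (@open_neq R 0) => T _; exact: cf.
Qed.

(** On the line from a point of [U] to [S], [f] is a polynomial with value [f S] at 1, so it has
    finitely many roots, whereas all parameters near 0 stay in [U]. *)
Lemma polyfun_neq0_dense (R : realType) (n1 n2 n3 : nat)
    (f : tensor R n1 n2 n3 -> R) (S : tensor R n1 n2 n3)
    (U : set (tensor R n1 n2 n3)) :
  polyfun f -> f S != 0 -> open U -> U !=set0 -> exists2 T, U T & f T != 0.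
Proof.
move=> [_ pf] fS oU [T0 UT0].
have [p pE] := pf T0 S.
have p0 : p != 0.
  apply: contraNneq fS => p0; have := pE 1; rewrite p0 horner0 => <-.
  apply/eqP; congr f; apply: funext => t; rewrite /tensor_line; ring.
have : \forall s \near (0 : R), U (tensor_line T0 S s).
  apply: (@tensor_line_continuous R n1 n2 n3 T0 S 0).
  apply: open_nbhs_nbhs; split=> //.
  suff -> : tensor_line T0 S 0 = T0 by [].
  by apply: funext => t; rewrite /tensor_line mul0r addr0.
move=> /nbhs_ballP[e /= e0 he].
have [//|hn] := pselect (exists2 T, U T & f T != 0); exfalso.
(* These are [size p] distinct parameters, more than [p] has roots; the shift by 2 keeps them
   strictly below [e]. *)
pose r := [seq e / (i.+2)%:R | i <- iota 0 (size p)].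
have rr : all (root p) r.
  apply/allP => _ /mapP[i _ ->]; apply/rootP; rewrite -pE.
  apply/eqP; apply: contra_notT hn => hf; exists (tensor_line T0 S (e / i.+2%:R)) => //.
  apply: he; rewrite /ball /= sub0r normrN gtr0_norm ?divr_gt0 ?ltr0n //.
  by rewrite ltr_pdivrMr ?ltr0n // ltr_pMr // ltr1n.
have ru : uniq r.
  rewrite map_inj_uniq ?iota_uniq // => i j /(mulfI (lt0r_neq0 e0)) /invr_inj.
  by move=> /eqP; rewrite eqr_nat => /eqP[].
by have := max_poly_roots p0 rr ru; rewrite size_map size_iota ltnn.
Qed.

(** * Generic bounds on the subrank *)

Lemma restricts_to_unit_le (R : realType) (n1 n2 n3 r s : nat)
    (T : tensor R n1 n2 n3) :
  (r <= s)%N -> restricts_to_unit T s -> restricts_to_unit T r.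
Proof.
move=> rs [A1 [A2 [A3 h]]].
pose w := widen_ord rs.
exists (rowsub w A1), (rowsub w A2), (rowsub w A3).
apply: funext => -[[a b] c].
have /(congr1 (fun F => F (w a, w b, w c))) := h.
rewrite /unit_tensor /tensor_apply /= => <-.
by do 3 (apply: eq_bigr => ? _); rewrite !mxE.
Qed.

Lemma subrank_eqP (R : realType) (n1 n2 n3 r : nat) (T : tensor R n1 n2 n3) :
  subrank_eq T r <-> restricts_to_unit T r /\ ~ restricts_to_unit T r.+1.
Proof.
split=> -[hr h]; split=> //; first by move=> /h; rewrite ltnn.
move=> s hs; rewrite leqNgt; apply/negP => rs; apply: h.
exact: restricts_to_unit_le rs hs.
Qed.

Definition slice (R : realType) (n1 n2 n3 : nat) (T : tensor R n1 n2 n3)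
    (a : 'I_n1) : 'M[R]_(n2, n3) := \matrix_(b, c) T (a, b, c).

Lemma tensor_apply_slice (R : realType) (n1 n2 n3 r : nat)
    (A1 : 'M[R]_(r, n1)) (A2 : 'M[R]_(r, n2)) (A3 : 'M[R]_(r, n3))
    (T : tensor R n1 n2 n3) a b c :
  tensor_apply A1 A2 A3 T (a, b, c) =
  \sum_i A1 a i * (A2 *m slice T i *m A3^T) b c.
Proof.
rewrite /tensor_apply /=; apply: eq_bigr => i _.
rewrite !mxE big_distrr exchange_big /=; apply: eq_bigr => k _.
rewrite !mxE mulr_suml big_distrr /=; apply: eq_bigr => j _.
by rewrite !mxE; ring.
Qed.

(** [E] is the inverse of [B], so it commutes with everything that commutes with [B]. *)
Lemma mulmx_inv_comm (R : comPzRingType) (n : nat) (A B E C : 'M[R]_n) :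
  E *m B = 1%:M -> B *m E = 1%:M ->
  A *m B = B *m A -> A *m C = C *m A -> B *m C = C *m B ->
  A *m E *m C = C *m E *m A.
Proof.
move=> EB BE AB AC BC.
have EC : E *m C = C *m E.
  by rewrite -[LHS]mulmx1 -BE mulmxA -(mulmxA E) -BC mulmxA EB mul1mx.
have EA : E *m A = A *m E.
  by rewrite -[LHS]mulmx1 -BE mulmxA -(mulmxA E) AB mulmxA EB mul1mx.
by rewrite -mulmxA EC mulmxA AC -mulmxA -EA mulmxA.
Qed.

(* The cofactor form of [M_a M_b^-1 M_c - M_c M_b^-1 M_a]; the extra determinant
   makes it vanish where [M_b] is singular. *)
Definition slice_commutator (R : realType) (n1 n : nat)
    (T : tensor R n1 n n) (a b c : 'I_n1) : 'M[R]_n :=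
  \det (slice T b) *: (slice T a *m \adj (slice T b) *m slice T c -
                       slice T c *m \adj (slice T b) *m slice T a).

(* After a change of bases the slices are diagonal, so that [M_b^-1 M_a] and
   [M_b^-1 M_c] commute. *)
Lemma slice_commutator_eq0 (R : realType) (n : nat) (T : tensor R n n n)
    (a b c : 'I_n) : restricts_to_unit T n -> slice_commutator T a b c = 0.
Proof.
move=> [A1 [A2 [A3 h]]].
have hE i j k : \sum_l A1 i l * (A2 *m slice T l *m A3^T) j k =
    ((i == j) && (j == k))%:R.
  by rewrite -tensor_apply_slice h /unit_tensor /=; case: ifP.
(* Summing over the first index turns the unit tensor into the identity matrix, which makes [A2] and
   [A3] invertible. *)
have A23 : A2 *m (\sum_i \sum_l A1 i l *: slice T l) *m A3^T = 1%:M.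
  apply/matrixP => j k; rewrite mulmx_sumr mulmx_suml summxE.
  rewrite (eq_bigr (fun i => ((i == j) && (j == k))%:R)); last first.
    move=> i _; rewrite -hE mulmx_sumr mulmx_suml summxE.
    by apply: eq_bigr => l _; rewrite -scalemxAr -scalemxAl mxE.
  rewrite (bigD1 j) //= eqxx big1 ?addr0 ?mxE // => i /negbTE ->.
  by [].
have A2u : A2 \in unitmx by move: A23; rewrite -mulmxA => /mulmx1_unit[].
have A3u : A3^T \in unitmx by move: A23 => /mulmx1_unit[].
pose D l := A2 *m slice T l *m A3^T.
have A1u : A1 \in unitmx.
  have : A1 *m (\matrix_(l, j) D l j j) = 1%:M.
    apply/matrixP => i j; rewrite !mxE -[RHS]/((i == j)%:R).
    under eq_bigr do rewrite mxE.
    by rewrite hE eqxx andbT.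
  by move=> /mulmx1_unit[].
(* For [j <> k], the invertible [A1] annihilates the vector of the entries [(j, k)] of all [D l], so
   these entries vanish. *)
have Ddiag l : D l = diag_mx (\row_j D l j j).
  apply/matrixP => j k; rewrite !mxE -/(D l).
  have [->|jk] := eqVneq j k; first by rewrite mulr1n.
  have : A1 *m (\col_l D l j k) = 0.
    apply/matrixP => i z; rewrite !mxE.
    under eq_bigr do rewrite mxE.
    by rewrite hE (negbTE jk) andbF.
  move=> /(congr1 (mulmx (invmx A1))); rewrite mulKmx // mulmx0.
  by move=> /matrixP/(_ l ord0); rewrite !mxE mulr0n.
have DC k l : D k *m D l = D l *m D k by rewrite Ddiag (Ddiag l) diag_mxC.
rewrite /slice_commutator.
have [->|db] := eqVneq (\det (slice T b)) 0; first by rewrite scale0r.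
have Mbu : slice T b \in unitmx by rewrite unitmxE unitfE.
have -> : \adj (slice T b) = \det (slice T b) *: invmx (slice T b).
  by rewrite /invmx Mbu scalerA divff // scale1r.
pose E := invmx A3^T *m invmx (slice T b) *m invmx A2.
have ED : E *m D b = 1%:M by rewrite /E /D -!mulmxA mulKmx // mulKmx // mulVmx.
have DE : D b *m E = 1%:M by apply: mulmx1C.
have DcE : D a *m E *m D c = D c *m E *m D a.
  by apply: (mulmx_inv_comm ED DE); rewrite DC.
have DED k l : D k *m E *m D l =
    A2 *m (slice T k *m invmx (slice T b) *m slice T l) *m A3^T.
  by rewrite /E /D -!mulmxA mulKVmx // mulKmx.
move: DcE; rewrite !DED => /(congr1 (mulmx (invmx A2))).
rewrite -!mulmxA !mulKmx // !mulmxA => /(congr1 (mulmxr (invmx A3^T))) /=.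
rewrite !mulmxK // => h'.
by rewrite -!scalemxAr -!scalemxAl h' subrr scaler0.
Qed.

Lemma slice_commutator_polyfun (R : realType) (n1 n : nat) (a b c : 'I_n1)
    (i j : 'I_n) :
  polyfun (fun T : tensor R n1 n n => slice_commutator T a b c i j).
Proof.
have hs (l : 'I_n1) p q : polyfun (fun T : tensor R n1 n n => slice T l p q).
  by under eq_fun do rewrite mxE; exact: polyfun_entry.
have hm k l : polyfun (fun T : tensor R n1 n n =>
    (slice T k *m \adj (slice T b) *m slice T l) i j).
  apply: polyfun_mulmx => //; apply: polyfun_mulmx => //.
  exact: polyfun_adj.
have -> : (fun T => slice_commutator T a b c i j) = (fun T : tensor R n1 n n =>
    \det (slice T b) * ((slice T a *m \adj (slice T b) *m slice T c) i j +
     (-1) * (slice T c *m \adj (slice T b) *m slice T a) i j)).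
  by apply: funext => T; rewrite !mxE mulN1r.
apply: polyfunM; first exact: polyfun_det.
by apply: polyfunD => //; apply: polyfunM => //; exact: polyfun_cst.
Qed.

(** With the identity as slice 1, the expression is the commutator of the matrix units [E_01] and
    [E_10], namely [E_00 - E_11]. *)
Lemma slice_commutator_neq0 (R : realType) :
  exists T : tensor R 4 4 4, slice_commutator T 0 1 (inord 2) 0 0 != 0.
Proof.
exists (fun t => if t.1.1 == 1 then (t.1.2 == t.2)%:R
  else if t.1.1 == 0 then ((t.1.2 == 0) && (t.2 == 1))%:R
  else ((t.1.2 == 1) && (t.2 == 0))%:R).
rewrite /slice_commutator.
set M0 := slice _ 0; set M1 := slice _ 1; set M2 := slice _ _.
have -> : M1 = 1%:M by apply/matrixP => i j; rewrite !mxE.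
have -> : M0 = delta_mx 0 1 by apply/matrixP => i j; rewrite !mxE.
have -> : M2 = delta_mx 1 0.
  apply/matrixP => i j; rewrite !mxE /=.
  by rewrite -!val_eqE /= inordK.
by rewrite adj1 det1 !mulmx1 scale1r !mul_delta_mx !mxE /= subr0 oner_neq0.
Qed.

(** * Norm estimates and contraction with two vectors *)

Lemma mx_norm_ge_entry (R : realType) (m n : nat) (v : 'M[R]_(m, n)) i j :
  `|v i j| <= `|v|.
Proof. by rewrite [leRHS]mx_normrE; exact: (le_bigmax _ _ (i, j)). Qed.

Lemma mx_norm_le (R : realType) (m n : nat) (v : 'M[R]_(m, n)) d :
  0 <= d -> (forall i j, `|v i j| <= d) -> `|v| <= d.
Proof.
by move=> d0 h; rewrite [leLHS]mx_normrE; apply: bigmax_le => // -[i j] _ /=.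
Qed.

(** If [v W = 0] then [v = - v (W - 1)], whence [|v| <= n c |v|] and [v = 0]. *)
Lemma near_id_unitmx (R : realType) (n : nat) (W : 'M[R]_n) (c : R) :
  (forall i j, `|W i j - (i == j)%:R| <= c) -> n%:R * c < 1 -> W \in unitmx.
Proof.
move=> hW hc; rewrite -row_free_unit; apply: inj_row_free => v vW.
apply/eqP; rewrite -normr_eq0.
case: n => [|n] in W hW hc v vW *.
  by rewrite normr_eq0; apply/eqP/matrixP => i [].
have c0 : 0 <= c by apply: le_trans (hW 0 0).
have : `|v| <= n.+1%:R * c * `|v|.
  apply: mx_norm_le => [|i j]; first by rewrite !mulr_ge0.
  have -> : v i j = - \sum_k v i k * (W k j - (k == j)%:R).
    have : (v *m W) i j = 0 by rewrite vW mxE.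
    rewrite mxE => vWj.
    under eq_bigr do rewrite mulrBr.
    rewrite sumrB vWj sub0r opprK (bigD1 j) //= eqxx mulr1 big1 ?addr0 // => k.
    by move=> /negbTE ->; rewrite mulr0.
  rewrite normrN; apply: le_trans (ler_norm_sum _ _ _) _.
  apply: (@le_trans _ _ (\sum_(k < n.+1) c * `|v|)).
    apply: ler_sum => k _; rewrite normrM mulrC.
    by apply: ler_pM => //; exact: mx_norm_ge_entry.
  by rewrite sumr_const card_ord -mulrA mulr_natl.
rewrite -subr_ge0 -{2}[`|v|]mul1r -mulrBl => h.
by rewrite eq_le normr_ge0 andbT -(nmulr_rge0 _ (_ : n.+1%:R * c - 1 < 0)) ?subr_lt0.
Qed.

Definition contract2 (R : realType) (n1 n2 n3 : nat) (T : tensor R n1 n2 n3)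
    (x : 'I_n1 -> R) (y : 'I_n2 -> R) (c : 'I_n3) : R :=
  \sum_(a < n1) \sum_(b < n2) x a * y b * T (a, b, c).

(** Once the [x_i] and [y_j] are chosen, a reduction to the unit tensor is a linear system for the
    [z_k]. *)
Lemma tensor_apply_contract2 (R : realType) (n1 n2 n3 r : nat)
    (A1 : 'M[R]_(r, n1)) (A2 : 'M[R]_(r, n2)) (A3 : 'M[R]_(r, n3))
    (T : tensor R n1 n2 n3) i j k :
  tensor_apply A1 A2 A3 T (i, j, k) =
  \sum_c A3 k c * contract2 T (A1 i) (A2 j) c.
Proof.
under [RHS]eq_bigr do rewrite big_distrr.
rewrite [RHS]exchange_big; apply: eq_bigr => a _ /=.
under [RHS]eq_bigr do rewrite big_distrr.
rewrite [RHS]exchange_big; apply: eq_bigr => b _ /=.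
by apply: eq_bigr => c _; ring.
Qed.

Lemma contract2_bound (R : realType) (n1 n2 n3 : nat) (T : tensor R n1 n2 n3)
    (x : 'I_n1 -> R) (y : 'I_n2 -> R) (c : 'I_n3) (p q e : R) :
  (forall a, `|x a| <= p) -> (forall b, `|y b| <= q) ->
  (forall a b, `|T (a, b, c)| <= e) ->
  `|contract2 T x y c| <= (n1 * n2)%:R * (p * q * e).
Proof.
move=> hx hy hT; apply: le_trans (ler_norm_sum _ _ _) _.
rewrite natrM -mulrA mulr_natl -[X in _ *+ X]card_ord -sumr_const.
apply: ler_sum => a _; apply: le_trans (ler_norm_sum _ _ _) _.
rewrite mulr_natl -[X in _ *+ X]card_ord -sumr_const.
apply: ler_sum => b _; rewrite !normrM; apply: ler_pM => //.
by apply: ler_pM.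
Qed.

(** * Tensors near the quaternion multiplication *)

Definition nonsingular_tensor (R : realType) (n1 n2 n3 : nat)
    (T : tensor R n1 n2 n3) : Prop :=
  forall x y, (forall c, contract2 T x y c = 0) ->
    (forall a, x a = 0) \/ (forall b, y b = 0).

(* If [z_1, z_2, z_3] complete a reduction to [I_3], both [T(x_1, y_2)] and
   [T(x_1, y_3)] lie on the line annihilated by the [z_k], so they are
   dependent and [T(x_1, -)] has a kernel. *)
Lemma nonsingular_not_restricts (R : realType) (n1 n2 : nat)
    (T : tensor R n1 n2 4) :
  nonsingular_tensor T -> ~ restricts_to_unit T 3.
Proof.
move=> nT [A1 [A2 [A3 h]]].
pose t i j := contract2 T (A1 i) (A2 j).
have hE i j k : \sum_c A3 k c * t i j c = ((i == j) && (j == k))%:R.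
  by rewrite -tensor_apply_contract2 h /unit_tensor /=; case: ifP.
pose B : 'M[R]_(2, 4) := \matrix_(l, c) t 0 (lift 0 l) c.
have A3r : \rank A3^T = 3%N.
  have : A3 *m (\matrix_(c, i) t i i c) = 1%:M.
    apply/matrixP => k i; rewrite !mxE.
    under eq_bigr do rewrite mxE.
    by rewrite hE eqxx eq_sym.
  move=> /(congr1 (fun M => \rank M)); rewrite mxrank1 mxrank_tr => rk.
  by apply/eqP; rewrite eqn_leq rank_leq_row -{1}rk mxrankM_maxl.
have BA3 : B *m A3^T = 0.
  apply/matrixP => l k; rewrite !mxE.
  by under eq_bigr do rewrite !mxE mulrC; rewrite hE.
have : ~~ row_free B.
  have := mulmx0_rank_max BA3; rewrite A3r /row_free.
  by case: eqP => // ->.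
rewrite -kermx_eq0 => /rowV0Pn[u /sub_kermxP uB u0].
pose y b := \sum_l u 0 l * A2 (lift 0 l) b.
have hy i c : contract2 T (A1 i) y c = \sum_l u 0 l * t i (lift 0 l) c.
  under [RHS]eq_bigr do rewrite big_distrr.
  rewrite [RHS]exchange_big; apply: eq_bigr => a _ /=.
  under [RHS]eq_bigr do rewrite big_distrr.
  rewrite [RHS]exchange_big; apply: eq_bigr => b _ /=.
  by rewrite mulr_sumr mulr_suml; apply: eq_bigr => l _; ring.
have /nT[x0|y0] : forall c, contract2 T (A1 0) y c = 0.
  move=> c; rewrite hy -[RHS](_ : (u *m B) 0 c = 0); last by rewrite uB mxE.
  by rewrite mxE; apply: eq_bigr => l _; rewrite mxE.
- have := hE 0 0 0; rewrite big1 => [/eqP|c _]; first by rewrite eq_sym oner_eq0.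
  rewrite /t /contract2 big1 ?mulr0 // => a _; rewrite big1 // => b _.
  by rewrite x0 !mul0r.
(* Pairing [T(x_i, y, -)] with [z_i] for [i = 2, 3] recovers the coefficients [u], which are thus
   0. *)
- move/negP: u0; apply; apply/eqP/matrixP => o l; rewrite ord1 mxE.
  have : \sum_c A3 (lift 0 l) c * contract2 T (A1 (lift 0 l)) y c = 0.
    rewrite big1 // => c _; rewrite /contract2 big1 ?mulr0 // => a _.
    by rewrite big1 // => b _; rewrite y0 mulr0 mul0r.
  move=> <-; under eq_bigr do rewrite hy big_distrr.
  rewrite exchange_big /=.
  transitivity (\sum_m u 0 m * (l == m)%:R).
    rewrite (bigD1 l) //= eqxx mulr1 big1 ?addr0 // => m.
    by rewrite eq_sym => /negbTE ->; rewrite mulr0.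
  apply: eq_bigr => m _; under [RHS]eq_bigr do rewrite mulrCA.
  by rewrite -big_distrr /= hE !(inj_eq lift_inj) (eq_sym m) andbb.
Qed.

(** The multiplication table of [1, i, j, k] up to sign; [quaternion_negative] marks the products
    with a minus sign. *)
Definition quaternion_index : seq (seq nat) :=
  [:: [:: 0; 1; 2; 3]; [:: 1; 0; 3; 2]; [:: 2; 3; 0; 1]; [:: 3; 2; 1; 0]]%N.

Definition quaternion_negative : seq (seq bool) :=
  [:: [:: false; false; false; false]; [:: false; true; false; true];
      [:: false; true; true; false]; [:: false; false; true; true]].

(* Structure constants of the quaternions in the basis [1, i, j, k]. *)
Definition quaternion_tensor (R : realType) : tensor R 4 4 4 := fun t =>
  if nth 0%N (nth [::] quaternion_index t.1.1) t.1.2 == t.2 :> nat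
  then (-1) ^+ nth false (nth [::] quaternion_negative t.1.1) t.1.2 else 0.

(** Euler's four-square identity: the quaternion norm is multiplicative. *)
Lemma quaternion_norm_mul (R : realType) (x y : 'I_4 -> R) :
  \sum_c contract2 (quaternion_tensor R) x y c ^+ 2 =
  (\sum_a x a ^+ 2) * (\sum_b y b ^+ 2).
Proof.
rewrite /contract2 !big_ord_recl !big_ord0 /quaternion_tensor /=.
ring.
Qed.

(** If [T(x, y, -) = 0], each coordinate of the quaternion product of [x] and [y] is at most
    [16/64 |x| |y|] in absolute value. The four squares then sum to at most [|x|^2 |y|^2 / 4], but
    the norm identity makes the sum [|x|^2 |y|^2]. *)
Lemma near_quaternion_nonsingular (R : realType) (T : tensor R 4 4 4) :
  tensor_ball (quaternion_tensor R) (64%:R^-1) T -> nonsingular_tensor T.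
Proof.
move=> hT x y hxy.
pose X := \sum_a x a ^+ 2; pose Y := \sum_b y b ^+ 2.
have sq_le n (z : 'I_n -> R) a : `|z a| <= Num.sqrt (\sum_a z a ^+ 2).
  rewrite -sqrtr_sqr ler_wsqrtr // (bigD1 a) //= lerDl.
  by apply: sumr_ge0 => b _; exact: sqr_ge0.
have sum0 n (z : 'I_n -> R) : \sum_a z a ^+ 2 = 0 -> forall a, z a = 0.
  move=> z0 a; apply/eqP; rewrite -normr_le0; apply: le_trans (sq_le _ z a) _.
  by rewrite z0 sqrtr0.
have X0 : 0 <= X by apply: sumr_ge0 => a _; exact: sqr_ge0.
have Y0 : 0 <= Y by apply: sumr_ge0 => a _; exact: sqr_ge0.
pose D : tensor R 4 4 4 := fun t => quaternion_tensor R t - T t.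
have hD c : contract2 (quaternion_tensor R) x y c ^+ 2 <= X * Y / 16%:R.
  have -> : contract2 (quaternion_tensor R) x y c = contract2 D x y c.
    rewrite -[LHS]subr0 -(hxy c) /contract2 -sumrB; apply: eq_bigr => a _.
    by rewrite -sumrB; apply: eq_bigr => b _; rewrite /D mulrBr.
  have : `|contract2 D x y c| <=
      (4 * 4)%:R * (Num.sqrt X * Num.sqrt Y * 64%:R^-1).
    apply: contract2_bound; [exact: sq_le | exact: sq_le |].
    by move=> a b; rewrite /D distrC; exact: ltW.
  have -> : X * Y / 16%:R = ((4 * 4)%:R * (Num.sqrt X * Num.sqrt Y * 64%:R^-1)) ^+ 2.
    by rewrite !exprMn !sqr_sqrtr //; field.
  by move=> h; rewrite -real_normK ?num_real // lerXn2r ?nnegrE ?(le_trans _ h).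
have : X * Y <= X * Y / 4%:R.
  rewrite -quaternion_norm_mul.
  apply: (@le_trans _ _ (\sum_(c < 4) X * Y / 16%:R)).
    by apply: ler_sum => c _; exact: hD.
  by rewrite sumr_const card_ord -quaternion_norm_mul -mulr_natl; lra.
have XY0 := mulr_ge0 X0 Y0.
move=> h; have /eqP : X * Y = 0 by lra.
by rewrite mulf_eq0 => /orP[]/eqP/sum0; [left | right].
Qed.

(* Row [l = i + 2 j] lists the functional [T(e_i, e_(2 j), -)], [i, j < 2]. *)
Definition corner_flattening (R : realType) (T : tensor R 4 4 4) : 'M[R]_4 :=
  \matrix_(l, c) T (inord (l %% 2), inord (2 * (l %/ 2)), c).

Lemma contract2_delta (R : realType) (n1 n2 n3 : nat) (T : tensor R n1 n2 n3)
    (x : 'I_n1 -> R) (y : 'I_n2 -> R) a0 b0 c :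
  (forall a, x a = (a == a0)%:R) -> (forall b, y b = (b == b0)%:R) ->
  contract2 T x y c = T (a0, b0, c).
Proof.
move=> hx hy; rewrite /contract2 (bigD1 a0) //= (bigD1 b0) //= hx hy !eqxx.
rewrite !mul1r big1 => [|b /negbTE hb]; last by rewrite hy hb mulr0 mul0r.
rewrite addr0 big1 ?addr0 // => a /negbTE ha.
by rewrite big1 // => b _; rewrite hx ha !mul0r.
Qed.

Lemma corner_flattening_restricts (R : realType) (T : tensor R 4 4 4) :
  corner_flattening T \in unitmx -> restricts_to_unit T 2.
Proof.
set N := corner_flattening T => Nu.
(* The pairs [i = j] are rows 0 and 3 of [N], whence the column [3 * k] of the inverse. *)
exists (\matrix_(i, a) (a == inord i)%:R), (\matrix_(j, b) (b == inord (2 * j))%:R),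
  (\matrix_(k, c) invmx N c (inord (3 * k))).
apply: funext => -[[i j] k]; rewrite tensor_apply_contract2.
have hl : (i + 2 * j < 4)%N by case: i j => [[|[|i]] //= _] [[|[|j]] //= _].
transitivity ((N *m invmx N) (inord (i + 2 * j)) (inord (3 * k))).
  rewrite mxE; apply: eq_bigr => c _; rewrite !mxE mulrC; congr (_ * _).
  rewrite (@contract2_delta _ _ _ _ _ _ _ (inord i) (inord (2 * j))).
  - rewrite inordK //; congr (T (inord _, inord _, _)).
      by case: (i) (j) => [[|[|?]] //= _] [[|[|?]] //= _].
    by case: (i) (j) => [[|[|?]] //= _] [[|[|?]] //= _].
  - by move=> a; rewrite mxE.
  - by move=> b; rewrite mxE.
rewrite mulmxV // mxE /unit_tensor /= -val_eqE /= !inordK //; last first.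
  by case: (k) => [[|[|?]] //= _].
by case: (i) (j) (k) => [[|[|?]] //= ?] [[|[|?]] //= ?] [[|[|?]] //= ?].
Qed.

(** At the quaternions the flattening is the identity, since [1, i] times [1, j] gives [1, i, j, k];
    this motivates the index [2 j]. *)
Lemma corner_flattening_near_quaternion (R : realType) (T : tensor R 4 4 4) :
  tensor_ball (quaternion_tensor R) (64%:R^-1) T ->
  corner_flattening T \in unitmx.
Proof.
move=> hT; apply: (@near_id_unitmx _ _ _ 64%:R^-1); last by lra.
move=> l c; rewrite mxE.
have -> : (l == c)%:R =
    quaternion_tensor R (inord (l %% 2), inord (2 * (l %/ 2)), c).
  rewrite /quaternion_tensor /= !inordK //.
    by case: l c => [[|[|[|[|?]]]] //= ?] [[|[|[|[|?]]]] //= ?].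
    by case: l => [[|[|[|[|?]]]] //= ?].
  by case: l => [[|[|[|[|?]]]] //= ?].
exact: ltW.
Qed.

Lemma corner_flattening_polyfun (R : realType) :
  polyfun (fun T : tensor R 4 4 4 => \det (corner_flattening T)).
Proof.
by apply: polyfun_det => i j; under eq_fun do rewrite mxE; exact: polyfun_entry.
Qed.

Lemma tensor_ball_center (R : realType) (n1 n2 n3 : nat)
    (S : tensor R n1 n2 n3) e : 0 < e -> tensor_ball S e S.
Proof. by move=> e0 a b c; rewrite subrr normr0. Qed.

(** * An open set of tensors restricting to the unit tensor of size 3 *)

(** Joins completeness with the norm on matrices, for [banach_fixed_point]. *)
HB.instance Definition _ (R : realType) (m n : nat) := Complete.on (matrix R m n).

(** Banach's theorem on the closed ball of radius [d], which [G] maps to itself because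
    [d/2 + |G 0| <= d]. *)
Lemma contraction_fixpoint_ball (R : realType) (m n : nat)
    (G : 'M[R]_(m, n) -> 'M[R]_(m, n)) (d : R) :
  0 <= d -> `|G 0| <= d / 2 ->
  (forall u v, `|u| <= d -> `|v| <= d -> `|G u - G v| <= 2^-1 * `|u - v|) ->
  exists2 v, `|v| <= d & G v = v.
Proof.
move=> d0 G0 Gc.
pose B : set 'M[R]_(m, n) := [set v | `|v| <= d].
have B0 : B 0 by rewrite /B /= normr0.
have GB : set_fun B B G.
  move=> v Bv; rewrite /B /= -(subrK (G 0) (G v)).
  have := Gc v 0 Bv B0; rewrite subr0 => h.
  by have := ler_normD (G v - G 0) (G 0); have : `|v| <= d by []; lra.
pose g := mkfun_fun GB.
have cg : is_contraction g.
  have q0 : 0 <= 2^-1 :> R by lra.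
  exists (NngNum q0); split => /=; first by lra.
  by move=> [u v] /= [Bu Bv]; exact: Gc.
have cB : closed B.
  have -> : B = [set v | (fun v => `|v|) v <= d] by [].
  by apply: closed_comp (@closed_le R d) => v _; exact: norm_continuous.
have [v Bv vE] := banach_fixed_point cg cB (ex_intro _ 0 B0).
by exists v.
Qed.

(* [I_3] together with the entries [(3, j, j + 1)] and [(j, 3, j + 1)],
   indices mod 3, chosen so that the off-diagonal equations
   [T(x_i, y_j, e_k) = 0] have invertible derivative at [x_i = y_i = e_i]. *)
Definition base_tensor (R : realType) : tensor R 4 4 4 := fun t =>
  if nat_of_ord t.2 == nth 4%N (nth [::]
       [:: [:: 0; 4; 4; 1]; [:: 4; 1; 4; 2]; [:: 4; 4; 2; 0]; [:: 1; 2; 0; 4]]%N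
       t.1.1) t.1.2 then 1 else 0.

Definition basis_fun (R : realType) (i : nat) (a : 'I_4) : R := (a == i :> nat)%:R.

(* The term [- v a a] cancels the contribution of the entries [(3, j, j + 1)]
   and [(j, 3, j + 1)], making the derivative at [0] the identity. *)
Definition displacement (R : realType) (u v : nat -> nat -> R) (i : nat)
    (a : 'I_4) : R :=
  if a == 3 :> nat then u i i else if a == i :> nat then 0
  else u i a - (if a == (i.+1 %% 3)%N :> nat then v a a else 0).

(* Entry [(l, m)] of the matrix of unknowns is coordinate [m] of [x_l] if
   [l < 3], of [y_(l - 3)] otherwise, except that the redundant coordinate [i] of
   [x_i] and [y_i] (normalized to 1) gives its place to coordinate 3. *)
Definition upper (R : realType) (w : 'M[R]_(6, 3)) (p q : nat) : R :=
  w (inord p) (inord q).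
Definition lower (R : realType) (w : 'M[R]_(6, 3)) (p q : nat) : R :=
  w (inord (3 + p)) (inord q).

Definition left_vector (R : realType) (w : 'M[R]_(6, 3)) (i : nat) (a : 'I_4) : R :=
  basis_fun R i a + displacement (upper w) (lower w) i a.
Definition right_vector (R : realType) (w : 'M[R]_(6, 3)) (j : nat) (b : 'I_4) : R :=
  basis_fun R j b + displacement (lower w) (upper w) j b.

(* The off-diagonal equation [(i, j, k)] whose derivative at 0 is the unknown
   [(l, m)]. *)
Definition equation_index (l m : nat) : nat * nat * nat :=
  if (l < 3)%N then
    if l == m then (l, (l.+1 %% 3)%N, (l.+2 %% 3)%N) else (l, m, m)
  else
    if (l - 3)%N == m then ((m.+1 %% 3)%N, m, (m.+2 %% 3)%N) else (m, (l - 3)%N, m).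

Definition reduction_value (R : realType) (T : tensor R 4 4 4) (w : 'M[R]_(6, 3))
    (t : nat * nat * nat) : R :=
  contract2 T (left_vector w t.1.1) (right_vector w t.1.2) (inord t.2).

(** By the product rule, this is the derivative at 0 of [reduction_value] for [base_tensor], as
    [displacement] is linear in the unknowns. *)
Definition base_derivative (R : realType) (w : 'M[R]_(6, 3))
    (t : nat * nat * nat) : R :=
  contract2 (base_tensor R) (displacement (upper w) (lower w) t.1.1)
    (basis_fun R t.1.2) (inord t.2) +
  contract2 (base_tensor R) (basis_fun R t.1.1)
    (displacement (lower w) (upper w) t.1.2) (inord t.2).

Lemma equation_indexP (l : 'I_6) (m : 'I_3) :
  let t := equation_index l m in
  [/\ (t.1.1 < 3)%N, (t.1.2 < 3)%N, (t.2 < 3)%N & t.1.1 != t.1.2].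
Proof.
by case: l m => [[|[|[|[|[|[|?]]]]]] //= ?] [[|[|[|?]]] //= ?].
Qed.

Lemma equation_index_surj (i j k : 'I_3) : i != j ->
  exists (l : 'I_6) (m : 'I_3), equation_index l m = (nat_of_ord i, nat_of_ord j, nat_of_ord k).
Proof.
move=> ij.
(* This inverts [equation_index]: the last two cases are the cyclic and anticyclic triples of
   distinct indices. *)
pose l := if k == j then nat_of_ord i else if k == i then (3 + j)%N else
  if nat_of_ord j == (i.+1 %% 3)%N then nat_of_ord i else (3 + j)%N.
pose m := if k == j then nat_of_ord j else if k == i then nat_of_ord i else
  if nat_of_ord j == (i.+1 %% 3)%N then nat_of_ord i else nat_of_ord j.
exists (inord l), (inord m); rewrite !inordK; last 2 first.
- by rewrite /m; do !case: ifP.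
- have := ltn_ord i; have := ltn_ord j.
  by rewrite /l; do !case: ifP => _; lia.
rewrite {}/l {}/m; move: i j k ij.
by case=> [[|[|[|?]]] //= ?]; case=> [[|[|[|?]]] //= ?]; case=> [[|[|[|?]]] //= ?].
Qed.

(** A computation in 18 cases. Thanks to it, subtracting the equations from the unknowns gives a
    contraction without inverting a matrix. *)
Lemma base_derivative_id (R : realType) (w : 'M[R]_(6, 3)) (l : 'I_6) (m : 'I_3) :
  base_derivative w (equation_index l m) = w l m.
Proof.
rewrite -[in RHS](inord_val l) -[in RHS](inord_val m).
case: l m => [[|[|[|[|[|[|?]]]]]] //= ?] [[|[|[|?]]] //= ?];
rewrite /base_derivative /equation_index /=;
rewrite /contract2 !big_ord_recl !big_ord0 /base_tensor /displacement /basis_fun /=;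
rewrite !inordK //= /upper /lower /=; ring.
Qed.

Lemma displacementB (R : realType) (u v u' v' u'' v'' : nat -> nat -> R) i a :
  (forall p q, u'' p q = u p q - u' p q) ->
  (forall p q, v'' p q = v p q - v' p q) ->
  displacement u v i a - displacement u' v' i a = displacement u'' v'' i a.
Proof.
move=> hu hv; rewrite /displacement.
case: ifP => _; first by rewrite hu.
case: ifP => _; first by rewrite subrr.
by rewrite hu; case: ifP => _; rewrite ?hv; ring.
Qed.

Lemma displacement_bound (R : realType) (u v : nat -> nat -> R) d i a :
  (forall p q, `|u p q| <= d) -> (forall p q, `|v p q| <= d) ->
  `|displacement u v i a| <= 2%:R * d.
Proof.
move=> hu hv; have d0 : 0 <= d by apply: le_trans (hu 0%N 0%N).
rewrite /displacement; case: ifP => _; first by have := hu i i; lra.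
case: ifP => _; first by rewrite normr0; lra.
apply: le_trans (ler_normB _ _) _; have := hu i a.
by case: ifP => _; rewrite ?normr0; [have := hv a a|]; lra.
Qed.

Lemma base_tensor_bound (R : realType) t : `|base_tensor R t| <= 1.
Proof. by rewrite /base_tensor; case: ifP => _; rewrite ?normr1 ?normr0. Qed.

Lemma basis_fun_bound (R : realType) i (a : 'I_4) : `|basis_fun R i a| <= 1.
Proof. by rewrite /basis_fun; case: (_ == _); rewrite ?normr1 ?normr0. Qed.

Lemma left_displacement_bound (R : realType) (w : 'M[R]_(6, 3)) d i a :
  `|w| <= d -> `|displacement (upper w) (lower w) i a| <= 2%:R * d.
Proof.
move=> hw; apply: displacement_bound => p q;
  exact: le_trans (mx_norm_ge_entry _ _ _) hw.
Qed.

Lemma right_displacement_bound (R : realType) (w : 'M[R]_(6, 3)) d i a :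
  `|w| <= d -> `|displacement (lower w) (upper w) i a| <= 2%:R * d.
Proof.
move=> hw; apply: displacement_bound => p q;
  exact: le_trans (mx_norm_ge_entry _ _ _) hw.
Qed.

Lemma vector_bound (R : realType) (w : 'M[R]_(6, 3)) i a :
  `|w| <= 400%:R^-1 ->
  `|left_vector w i a| <= 2%:R /\ `|right_vector w i a| <= 2%:R.
Proof.
move=> hw; have hb := basis_fun_bound R i a.
split; apply: le_trans (ler_normD _ _) _.
- by have := left_displacement_bound i a hw; lra.
- by have := right_displacement_bound i a hw; lra.
Qed.

(** With [T = base_tensor + D], each term left after removing the derivative contains the small [D]
    or two displacements. *)
Lemma reduction_value_contraction (R : realType) (T : tensor R 4 4 4)
    (v v' : 'M[R]_(6, 3)) t :
  tensor_ball (base_tensor R) (20000%:R^-1) T ->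
  `|v| <= 400%:R^-1 -> `|v'| <= 400%:R^-1 ->
  `|reduction_value T v t - reduction_value T v' t - base_derivative (v - v') t|
    <= 2^-1 * `|v - v'|.
Proof.
move=> hT hv hv'; case: t => [[i j] k]; set r := `|v - v'|.
pose D : tensor R 4 4 4 := fun t => T t - base_tensor R t.
have hD a b : `|D (a, b, inord k)| <= 20000%:R^-1 by apply: ltW; exact: hT.
have hB a b : `|base_tensor R (a, b, inord k)| <= 1 := base_tensor_bound R _.
pose dx := displacement (upper (v - v')) (lower (v - v')) i.
pose dy := displacement (lower (v - v')) (upper (v - v')) j.
pose dx' := displacement (upper v') (lower v') i.
pose dy0 := displacement (lower v) (upper v) j.
have dxE a : displacement (upper v) (lower v) i a =
    displacement (upper v') (lower v') i a + dx a.
  rewrite /dx -(@displacementB _ (upper v) (lower v) (upper v') (lower v') (upper (v - v'))).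
  - by ring.
  - by move=> p q; rewrite /upper !mxE.
  - by move=> p q; rewrite /lower !mxE.
have dyE b : displacement (lower v) (upper v) j b =
    displacement (lower v') (upper v') j b + dy b.
  rewrite /dy -(@displacementB _ (lower v) (upper v) (lower v') (upper v') (lower (v - v'))).
  - by ring.
  - by move=> p q; rewrite /lower !mxE.
  - by move=> p q; rewrite /upper !mxE.
have hdx a : `|dx a| <= 2%:R * r by exact: left_displacement_bound.
have hdy b : `|dy b| <= 2%:R * r by exact: right_displacement_bound.
have hdx' a : `|dx' a| <= 2%:R * 400%:R^-1 by exact: left_displacement_bound.
have hdy0 b : `|dy0 b| <= 2%:R * 400%:R^-1 by exact: right_displacement_bound.
have -> : reduction_value T v (i, j, k) - reduction_value T v' (i, j, k) -
      base_derivative (v - v') (i, j, k) =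
    contract2 D dx (right_vector v j) (inord k) +
    contract2 (base_tensor R) dx dy0 (inord k) +
    contract2 D (left_vector v' i) dy (inord k) +
    contract2 (base_tensor R) dx' dy (inord k).
  rewrite /reduction_value /base_derivative /contract2 /= -/dx -/dy.
  rewrite -sumrB -!big_split -sumrB; apply: eq_bigr => a _.
  rewrite -sumrB -!big_split -sumrB; apply: eq_bigr => b _ /=.
  by rewrite /left_vector /right_vector /dy0 /dx' /D dxE dyE; ring.
have B1 : `|contract2 D dx (right_vector v j) (inord k)| <=
    (4 * 4)%:R * (2%:R * r * 2%:R * 20000%:R^-1).
  by apply: contract2_bound => // b; exact: (vector_bound j b hv).2.
have B2 := contract2_bound hdx hdy0 hB.
have B3 : `|contract2 D (left_vector v' i) dy (inord k)| <=
    (4 * 4)%:R * (2%:R * (2%:R * r) * 20000%:R^-1).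
  by apply: contract2_bound => // b; exact: (vector_bound i b hv').1.
have B4 := contract2_bound hdx' hdy hB.
have r0 : 0 <= r by exact: normr_ge0.
have n1 := ler_normD (contract2 D dx (right_vector v j) (inord k))
  (contract2 (base_tensor R) dx dy0 (inord k)).
have n2 := ler_normD (contract2 D dx (right_vector v j) (inord k) +
  contract2 (base_tensor R) dx dy0 (inord k)) (contract2 D (left_vector v' i) dy (inord k)).
(* The two terms with [D] are at most [64/20000 r] each, the other two at most [64/400 r], in total
   at most [r/2]. *)
apply: le_trans (ler_normD _ _) _.
rewrite natrM in B1 B2 B3 B4.
lra.
Qed.

Lemma displacement0 (R : realType) i (a : 'I_4) :
  displacement (upper (0 : 'M[R]_(6, 3))) (lower 0) i a = 0 /\
  displacement (lower (0 : 'M[R]_(6, 3))) (upper 0) i a = 0.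
Proof.
by rewrite /displacement /upper /lower !mxE; do !case: ifP; rewrite ?subr0.
Qed.

Lemma reduction_value_0 (R : realType) (T : tensor R 4 4 4) (i j k : nat) :
  (i < 4)%N -> (j < 4)%N ->
  reduction_value T 0 (i, j, k) = T (inord i, inord j, inord k).
Proof.
move=> hi hj; apply: contract2_delta => a.
  by rewrite /left_vector (displacement0 R i a).1 addr0 -val_eqE /= inordK.
by rewrite /right_vector (displacement0 R j a).2 addr0 -val_eqE /= inordK.
Qed.

(** In the table of [base_tensor] the value 4 matches no index and stands for a zero row of
    entries. *)
Lemma base_tensor_corner (R : realType) (i j k : nat) :
  (i < 3)%N -> (j < 3)%N -> (k < 3)%N ->
  base_tensor R (inord i, inord j, inord k) = ((i == j) && (j == k))%:R.
Proof.
move=> hi hj hk; rewrite /base_tensor /= !inordK 1?leqW //.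
by case: i hi => [|[|[|?]]] //; case: j hj => [|[|[|?]]] //;
  case: k hk => [|[|[|?]]] //.
Qed.

(** The zeros of the system [F] are the fixed points of [v - F v]. The entries of [F 0] are
    off-diagonal entries of [T], below [1/20000] and so below half the radius. *)
Lemma reduction_value_zero (R : realType) (T : tensor R 4 4 4) :
  tensor_ball (base_tensor R) (20000%:R^-1) T ->
  exists2 v : 'M[R]_(6, 3), `|v| <= 400%:R^-1 &
    forall i j k : 'I_3, i != j ->
      reduction_value T v (nat_of_ord i, nat_of_ord j, nat_of_ord k) = 0.
Proof.
move=> hT.
pose F (v : 'M[R]_(6, 3)) := \matrix_(l < 6, m < 3) reduction_value T v (equation_index l m).
have [|||v hv Fv] := @contraction_fixpoint_ball R 6 3 (fun v => v - F v) 400%:R^-1.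
- by lra.
- rewrite sub0r normrN; apply: mx_norm_le => [|l m]; first by lra.
  rewrite mxE; case: (equation_indexP l m).
  case: (equation_index l m) => [[i j] k] /= hi hj hk ij.
  rewrite reduction_value_0 1?leqW //.
  have := hT (inord i) (inord j) (inord k).
  rewrite base_tensor_corner // (negbTE ij) subr0 => h.
  by apply: le_trans (ltW h) _; lra.
- move=> u v hu hv; apply: mx_norm_le => [|l m]; first by rewrite mulr_ge0 ?invr_ge0.
  rewrite !mxE distrC.
  have := reduction_value_contraction (equation_index l m) hT hu hv.
  rewrite base_derivative_id !mxE => h; apply: le_trans h.
  by rewrite le_eqVlt; apply/orP; left; apply/eqP; congr `|_|; ring.
exists v => // i j k ij.
have [l [m <-]] := equation_index_surj k ij.
have : F v = 0 by rewrite -[LHS](subKr v) Fv subrr.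
by move=> /matrixP/(_ l m); rewrite !mxE.
Qed.

Lemma near_base_restricts (R : realType) (T : tensor R 4 4 4) :
  tensor_ball (base_tensor R) (20000%:R^-1) T -> restricts_to_unit T 3.
Proof.
move=> hT; have [v hv v0] := reduction_value_zero hT.
pose W : 'M[R]_3 := \matrix_(i, k) reduction_value T v (nat_of_ord i, nat_of_ord i, nat_of_ord k).
(* The entries deviate from the identity by at most [64/20000 + 64/400 + 32/400 < 1/4], and
   [3/4 < 1]. *)
have Wu : W \in unitmx.
  apply: (@near_id_unitmx _ _ _ (4%:R^-1)); last by lra.
  move=> i k; rewrite mxE.
  pose D : tensor R 4 4 4 := fun t => T t - base_tensor R t.
  pose c : 'I_4 := inord k.
  have -> : (i == k)%:R = contract2 (base_tensor R) (basis_fun R i) (basis_fun R i) c.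
    rewrite (@contract2_delta _ _ _ _ _ _ _ (inord i) (inord i)).
    - by rewrite base_tensor_corner // eqxx.
    - by move=> a; rewrite /basis_fun -val_eqE /= inordK // leqW.
    - by move=> a; rewrite /basis_fun -val_eqE /= inordK // leqW.
  pose dx := displacement (upper v) (lower v) i.
  pose dy := displacement (lower v) (upper v) i.
  have -> : reduction_value T v (nat_of_ord i, nat_of_ord i, nat_of_ord k) -
      contract2 (base_tensor R) (basis_fun R i) (basis_fun R i) c =
      contract2 D (left_vector v i) (right_vector v i) c +
      contract2 (base_tensor R) dx (right_vector v i) c +
      contract2 (base_tensor R) (basis_fun R i) dy c.
    rewrite /reduction_value /contract2 /=.
    rewrite -sumrB -!big_split; apply: eq_bigr => a _.
    rewrite -sumrB -!big_split; apply: eq_bigr => b _ /=.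
    by rewrite /left_vector /right_vector /D /dx /dy; ring.
  have hx a : `|left_vector v i a| <= 2%:R := (vector_bound i a hv).1.
  have hy a : `|right_vector v i a| <= 2%:R := (vector_bound i a hv).2.
  have hdx a : `|dx a| <= 2%:R * 400%:R^-1 by exact: left_displacement_bound.
  have hdy a : `|dy a| <= 2%:R * 400%:R^-1 by exact: right_displacement_bound.
  have hD a b : `|D (a, b, c)| <= 20000%:R^-1 by apply: ltW; exact: hT.
  have hB a b : `|base_tensor R (a, b, c)| <= 1 := base_tensor_bound R _.
  have B1 := contract2_bound hx hy hD.
  have B2 := contract2_bound hdx hy hB.
  have B3 := contract2_bound (basis_fun_bound R i) hdy hB.
  rewrite natrM in B1 B2 B3.
  have n1 := ler_normD (contract2 D (left_vector v i) (right_vector v i) c)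
    (contract2 (base_tensor R) dx (right_vector v i) c).
  by apply: le_trans (ler_normD _ _) _; lra.
exists (\matrix_(i, a) left_vector v i a), (\matrix_(j, b) right_vector v j b).
(* The [z_k] are columns of the inverse, padded by 0 in coordinate 3, where no equation was
   solved. *)
exists (\matrix_(k, c) if (c < 3)%N then invmx W (inord c) k else 0).
apply: funext => -[[i j] k]; rewrite tensor_apply_contract2.
transitivity (\sum_(c < 3) invmx W c k *
    reduction_value T v (nat_of_ord i, nat_of_ord j, nat_of_ord c)).
  rewrite big_ord_recr /= [X in _ + X](_ : _ = 0) ?addr0; last first.
    by rewrite mxE /= mul0r.
  apply: eq_bigr => c _; rewrite mxE /= ltn_ord inord_val; congr (_ * _).
  rewrite /reduction_value /contract2 /=; apply: eq_bigr => a _.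
  apply: eq_bigr => b _; rewrite !mxE; congr (_ * T (_, _, _)).
  by apply: val_inj; rewrite /= inordK // leqW.
rewrite /unit_tensor /=; have [<-|ij] := eqVneq i j; last first.
  by rewrite big1 // => c _; rewrite v0 ?mulr0.
have <- : (W *m invmx W) i k = (if i == k then 1 else 0).
  by rewrite mulmxV // mxE; case: ifP.
by rewrite mxE; apply: eq_bigr => c _; rewrite mxE mulrC.
Qed.

(** * The typical subranks *)

Lemma restricts_to_unit_4_nongeneric (R : realType) (U : set (tensor R 4 4 4)) :
  open U -> U !=set0 -> exists2 T, U T & ~ restricts_to_unit T 4.
Proof.
move=> oU U0; have [S hS] := slice_commutator_neq0 R.
have [T UT hT] :=
  polyfun_neq0_dense (@slice_commutator_polyfun R 4 4 0 1 (inord 2) 0 0) hS oU U0.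
exists T => // /(slice_commutator_eq0 0 1 (inord 2)) h.
by move: hT; rewrite h mxE eqxx.
Qed.

Lemma restricts_to_unit_2_generic (R : realType) (U : set (tensor R 4 4 4)) :
  open U -> U !=set0 -> exists2 T, U T & restricts_to_unit T 2.
Proof.
move=> oU U0.
have q0 : \det (corner_flattening (quaternion_tensor R)) != 0.
  rewrite -unitfE -unitmxE; apply: corner_flattening_near_quaternion.
  by apply: tensor_ball_center; rewrite invr_gt0.
have [T UT hT] := polyfun_neq0_dense (corner_flattening_polyfun R) q0 oU U0.
by exists T => //; apply: corner_flattening_restricts; rewrite unitmxE unitfE.
Qed.

Lemma typical_subrank_2 (R : realType) : typical_subrank R 4 4 4 2.
Proof.
exists (tensor_ball (quaternion_tensor R) 64%:R^-1); split.
  exact: tensor_ball_open.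
split; first by exists (quaternion_tensor R); apply: tensor_ball_center; rewrite invr_gt0.
move=> T hT; apply/subrank_eqP; split.
  by apply: corner_flattening_restricts; exact: corner_flattening_near_quaternion.
by apply: nonsingular_not_restricts; exact: near_quaternion_nonsingular.
Qed.

Lemma typical_subrank_3 (R : realType) : typical_subrank R 4 4 4 3.
Proof.
have fP : polyfun (fun T : tensor R 4 4 4 => slice_commutator T 0 1 (inord 2) 0 0).
  exact: slice_commutator_polyfun.
pose B := tensor_ball (base_tensor R) 20000%:R^-1.
(* The ball ensures subrank at least 3; a nonzero commutator excludes 4. *)
exists (B `&` [set T | slice_commutator T 0 1 (inord 2) 0 0 != 0]); split.
  by apply: openI; [exact: tensor_ball_open | exact: polyfun_neq0_open fP].
split.
  have [S hS] := slice_commutator_neq0 R.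
  have B0 : B !=set0.
    by exists (base_tensor R); apply: tensor_ball_center; rewrite invr_gt0.
  by have [T BT hT] := polyfun_neq0_dense fP hS (tensor_ball_open _ _) B0; exists T.
move=> T [BT hT]; apply/subrank_eqP; split; first exact: near_base_restricts.
move=> /(slice_commutator_eq0 0 1 (inord 2)) h.
by move: hT; rewrite /= h mxE eqxx.
Qed.

Theorem theorem4p13 (R : realType) (r : nat) :
  typical_subrank R 4 4 4 r <-> r = 2%N \/ r = 3%N.
Proof.
split=> [[U [oU [U0 hU]]]|[->|->]]; last 2 first.
- exact: typical_subrank_2.
- exact: typical_subrank_3.
(* Both [T] and [S] lie in [U] and have subrank exactly [r]: [T] bounds [r] from below, [S] from
   above. *)
have [T UT T2] := restricts_to_unit_2_generic oU U0.
have [S US S4] := restricts_to_unit_4_nongeneric oU U0.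
have r2 : (2 <= r)%N by apply: (hU T UT).2.
have r4 : (r < 4)%N.
  rewrite ltnNge; apply/negP => r4; apply: S4.
  exact: restricts_to_unit_le r4 (hU S US).1.
by case: r r2 r4 {hU} => [|[|[|[|r]]]] // _ _; [left | right].
Qed.
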